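(* Good atlases as objects, compatible systems as 1-cells, and natural transformations of compatible systems as 2-cells (with the compositions and identities described in the context) form a 2-category, denoted $\mathbf{GOrbAtl}$.
   Context: **Charts and atlases.** All spaces $X,Y,Z$ are paracompact, second countable and Hausdorff; all charts and atlases are effective and of a fixed dimension $n$. A chart over a connected open subset $U\subseteq X$ is a triple $(\tilde U,G,\pi)$ where $\tilde U\subseteq\mathbb R^n$ is connected and open, $G<\mathrm{Diff}(\tilde U)$ is a finite group of smooth automorphisms acting effectively on $\tilde U$, and $\pi:\tilde U\to U$ is a continuous, surjective, $G$-invariant map inducing a homeomorphism $\tilde U/G\cong U$. The case $\tilde U=\varnothing$ (trivial group, empty map) is allowed. For open $U\subseteq V\subseteq X$, an embedding $\lambda:(\tilde U,G,\pi)\to(\tilde V,H,\tau)$ of charts is a smooth embedding $\lambda:\tilde U\to\tilde V$ lifting the inclusion $U\hookrightarrow V$, i.e. $\tau\circ\lambda=\pi$. An atlas on $X$ is a family $\mathcal U=\{(\tilde U_i,G_i,\pi_i)\mid i\in I\}$ of charts on $X$ such that the sets $U_i=\pi_i(\tilde U_i)$ cover $X$ and for each $x\in U_i\cap U_j$ there is a chart $(\tilde U_k,G_k,\pi_k)\in\mathcal U$ with $x\in U_k\subseteq U_i\cap U_j$ and embeddings of it into $(\tilde U_i,G_i,\pi_i)$ and $(\tilde U_j,G_j,\pi_j)$. An atlas is regarded as a small category whose objects are its (indexed) charts and whose morphisms are the embeddings between them. **Good atlases.** A good atlas on $X$ is an atlas $\mathcal U=\{(\tilde U_I,G_I,\pi_I)\mid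 I\in\mathsf{Fin}(V_{\mathcal U})\}$ such that, with $U_I=\pi_I(\tilde U_I)$: (1) $V_{\mathcal U}$ is a countable set and $\mathsf{Fin}(V_{\mathcal U})$ is the set of all non-empty finite subsets of $V_{\mathcal U}$; (2) $\{U_i:=U_{\{i\}}\mid i\in V_{\mathcal U}\}$ is a locally finite open cover of $X$; (3) each $\tilde U_I$ is contractible whenever non-empty, and so is $U_I$; (4) $U_I=U_{I_0}\cap\dots\cap U_{I_p}$ ($p\ge 0$) if $I=I_0\cup\dots\cup I_p$, and it is uniformized by $(\tilde U_I,G_I,\pi_I)\in\mathcal U$; (5) there is an embedding $\lambda_{IJ}:(\tilde U_I,G_I,\pi_I)\to(\tilde U_J,G_J,\pi_J)$ in $\mathcal U$ whenever $U_I\subseteq U_J$. **Compatible systems.** Let $\mathcal U=\{(\tilde U_I,G_I,\pi_I)\}$ and $\mathcal V=\{(\tilde V_K,H_K,\tau_K)\}$ be good atlases on $X$ and $Y$. A compatible system $\tilde f:\mathcal U\to\mathcal V$ for a continuous map $f:X\to Y$ consists of: (1) a functor $\tilde f:\mathcal U\to\mathcal V$, whose underlying map on objects is a map $\tilde f:\mathsf{Fin}(V_{\mathcal U})\to\mathsf{Fin}(V_{\mathcal V})$, such that $f(\pi_I(\tilde U_I))\subseteq\tau_{\tilde fI}(\tilde V_{\tilde fI})$ and $\tilde f(I_1\cup\dots\cup I_p)=(\tilde fI_1)\cup\dots\cup(\tilde fI_p)$ for all $I,I_1,\dots,I_p$; (2) a family of smooth maps $\tilde f_I:\tilde U_I\to\tilde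 V_{\tilde fI}$ ($I\in\mathsf{Fin}(V_{\mathcal U})$) lifting $f|_{U_I}$, i.e. $\tau_{\tilde fI}\circ\tilde f_I=f\circ\pi_I$, with $\tilde f_J\circ\lambda_{IJ}=(\tilde f\lambda_{IJ})\circ\tilde f_I$ for all embeddings $\lambda_{IJ}:(\tilde U_I,G_I,\pi_I)\to(\tilde U_J,G_J,\pi_J)$ in $\mathcal U$. The composite of $\tilde f:\mathcal U\to\mathcal V$ (for $f$) and $\tilde g:\mathcal V\to\mathcal W$ (for $g$) is the composite functor together with the liftings $(\tilde g\circ\tilde f)_I:=\tilde g_{\tilde fI}\circ\tilde f_I$ of $g\circ f$. The identity on $\mathcal U$ is the identity functor with identity liftings. **Natural transformations of compatible systems.** Let $\tilde f^1,\tilde f^2:\mathcal U\to\mathcal V$ be compatible systems for the same continuous map $f$. A natural transformation $\alpha:\tilde f^1\Rightarrow\tilde f^2$ of functors (so each $\alpha_I:(\tilde V_{\tilde f^1I},H_{\tilde f^1I},\tau_{\tilde f^1I})\to(\tilde V_{\tilde f^2I},H_{\tilde f^2I},\tau_{\tilde f^2I})$ is an embedding in $\mathcal V$) is a natural transformation of compatible systems if $\tilde f^2_I=\alpha_I\circ\tilde f^1_I$ for all $I$. Vertical and horizontal compositions and identities of 2-cells are those of natural transformations in the 2-category $\mathbf{Cat}$ of small categories, functors and natural transformations. *)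

(* Defs.v *)
From HB Require Import structures.
From mathcomp Require Import all_boot all_order all_algebra finmap.
From mathcomp Require Import generic_quotient.
From mathcomp Require Import all_classical all_reals all_analysis.

Set Implicit Arguments.
Unset Strict Implicit.
Unset Printing Implicit Defensive.

Import Order.TTheory GRing.Theory Num.Theory numFieldNormedType.Exports.
Local Open Scope classical_set_scope.
Local Open Scope ring_scope.
Local Open Scope quotient_scope.


Section Smooth.
Context {R : realType}.

(* f is C^k on the open set A: f is differentiable on A and all its directional
   derivatives are C^(k-1) on A. *)
Fixpoint Ck (k : nat) (m : nat) (W : normedModType R) (A : set 'rV[R]_m)
    (f : 'rV[R]_m -> W) : Prop :=
  match k with
  | 0 => forall x, A x -> {for x, continuous f}
  | k'.+1 => (forall x, A x -> differentiable f x) /\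
             (forall v, Ck k' A ('D_v f))
  end.

Definition smooth_on m (W : normedModType R) (A : set 'rV[R]_m)
  (f : 'rV[R]_m -> W) : Prop := forall k, Ck k A f.

Lemma near_differentiable (V W : normedModType R) (f g : V -> W) x :
  (\forall y \near x, f y = g y) -> differentiable f x ->
  differentiable g x /\ 'd g x = 'd f x :> (V -> W).
Proof.
move=> fg df; pose h : V -> W := g - f.
have h0 : \forall y \near x, h y = 0.
  by apply: filterS fg => y e; rewrite /h !fctE e subrr.
have hx : h x = 0 by exact: nbhs_singleton h0.
pose z : {linear V -> W} := \0.
have zc : continuous z by move=> y; exact: cvg_cst.
have e : h \o shift x = cst (h x) + z +o_ 0 id.
  apply/eqaddoP => _/posnumP[eps]; near=> y.
  rewrite !fctE /= hx; change (z y) with (0 : W); rewrite addr0 subr0.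
  have -> : h (y + x) = 0.
    near: y; move: h0; rewrite (near_shift 0 x) /=.
    by apply: filterS => y; rewrite /= subr0.
  by rewrite normr0 mulr_ge0.
have dh : 'd h x = z :> (V -> W) by exact: diff_unique.
have hd : differentiable h x by apply/diff_locallyP; rewrite dh.
have -> : g = h + f by rewrite /h subrK.
split; first exact: differentiableD.
by rewrite diffD // dh; apply/funext => y; exact: add0r.
Unshelve. all: by end_near. Qed.

Lemma Ck_eq k m (W : normedModType R) (A : set 'rV[R]_m) (f g : 'rV[R]_m -> W) :
  open A -> (forall x, A x -> f x = g x) -> Ck k A f -> Ck k A g.
Proof.
move=> oA; elim: k f g => [|k IH] f g fg /=.
  move=> cf x Ax; have fgx : \forall y \near x, f y = g y.
    by apply: filterS (open_nbhs_nbhs (conj oA Ax)) => y; exact: fg.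
  rewrite /prop_for /continuous_at -(fg _ Ax).
  by move=> P /(cf _ Ax); apply: filterS2 fgx => y /= <-.
move=> [df dk].
have near_fg x : A x -> \forall y \near x, f y = g y.
  by move=> Ax; apply: filterS (open_nbhs_nbhs (conj oA Ax)) => y; exact: fg.
split=> [x Ax|v].
  by have [] := near_differentiable (near_fg _ Ax) (df _ Ax).
apply: IH (dk v) => x Ax.
have [dg e] := near_differentiable (near_fg _ Ax) (df _ Ax).
by rewrite !deriveE ?e //; exact: df.
Qed.

Lemma CkS k m (W : normedModType R) (A : set 'rV[R]_m) (f : 'rV[R]_m -> W) :
  Ck k.+1 A f -> Ck k A f.
Proof.
elim: k f => [|k IH] f [df dk].
  by move=> x Ax; apply: differentiable_continuous; exact: df.
by split=> // v; apply: IH; exact: dk.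
Qed.

Lemma CkD k m (W : normedModType R) (A : set 'rV[R]_m) (f g : 'rV[R]_m -> W) :
  open A -> Ck k A f -> Ck k A g -> Ck k A (f + g).
Proof.
move=> oA; elim: k f g => [|k IH] f g /=.
  by move=> cf cg x Ax; apply: continuousD; [exact: cf|exact: cg].
move=> [df ck] [dg cg]; split=> [x Ax|v].
  by apply: differentiableD; [exact: df|exact: dg].
apply: Ck_eq (IH _ _ (ck v) (cg v)) => // x Ax.
by rewrite deriveD //; apply: diff_derivable; [exact: df|exact: dg].
Qed.

Lemma Ck_cst k m (W : normedModType R) (A : set 'rV[R]_m) (w : W) :
  Ck k A (cst w).
Proof.
elim: k w => [|k IH] w /=; first by move=> x _; exact: cst_continuous.
split=> [x _|v]; first exact: differentiable_cst.
have -> : 'D_v (cst w : 'rV[R]_m -> W) = cst 0.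
  by apply/funext => x; rewrite derive_cst.
exact: IH.
Qed.

Lemma CkM k m (A : set 'rV[R]_m) (f g : 'rV[R]_m -> R) :
  open A -> Ck k A f -> Ck k A g -> Ck k A (f * g).
Proof.
move=> oA; elim: k f g => [|k IH] f g /=.
  by move=> cf cg x Ax; apply: continuousM; [exact: cf|exact: cg].
move=> [df ck] [dg cg]; split=> [x Ax|v].
  by apply: differentiableM; [exact: df|exact: dg].
have ckf : Ck k A f by apply: CkS; split.
have ckg : Ck k A g by apply: CkS; split.
apply: Ck_eq (CkD oA (IH _ _ ckf (cg v)) (IH _ _ ckg (ck v))) => // x Ax.
rewrite deriveM; first by rewrite !fctE /= .
- by apply: diff_derivable; exact: df.
- by apply: diff_derivable; exact: dg.
Qed.

Lemma Ck_sum k m (W : normedModType R) (A : set 'rV[R]_m) n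
    (f : 'I_n -> 'rV[R]_m -> W) :
  open A -> (forall i, Ck k A (f i)) -> Ck k A (\sum_(i < n) f i).
Proof.
move=> oA cf; elim/big_ind: _ => //; first exact: Ck_cst.
by move=> g h; exact: CkD.
Qed.

Definition coordf m n (f : 'rV[R]_m -> 'rV[R]_n) (j : 'I_n) : 'rV[R]_m -> R :=
  fun x => f x ord0 j.

Lemma coordf_diff m n (f : 'rV[R]_m -> 'rV[R]_n) x j :
  differentiable f x -> differentiable (coordf f j) x /\
  forall v, 'd (coordf f j) x v = 'd f x v ord0 j.
Proof.
move=> df; pose c := fun N : 'rV[R]_n => N ord0 j.
have lc : linear c by move=> a u v; rewrite /c !mxE.
pose cM := GRing.isLinear.Build _ _ _ _ c lc.
pose cL : {linear 'rV[R]_n -> R} := HB.pack c cM.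
have cc : continuous cL by exact: coord_continuous.
have dc y : differentiable cL y by exact: linear_differentiable.
have -> : coordf f j = cL \o f by [].
split; first exact: differentiable_comp.
move=> v; rewrite diff_comp //.
by change (('d cL (f x) : _ -> R) ('d f x v) = cL ('d f x v)); rewrite (diff_lin (f x) cc).
Qed.

Lemma coordf_sum m n (f : 'rV[R]_m -> 'rV[R]_n) :
  f = \sum_(j < n) (fun x => coordf f j x *: delta_mx 0 j).
Proof.
apply/funext => x; rewrite {1}(row_sum_delta (f x)) fct_sumE; apply: eq_bigr => j _.
by rewrite /coordf ord1.
Qed.

Lemma Ck_coord k m n (A : set 'rV[R]_m) (f : 'rV[R]_m -> 'rV[R]_n) :
  open A -> Ck k A f <-> forall j, Ck k A (coordf f j).
Proof.
move=> oA; elim: k f => [|k IH] f.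
  split=> [cf j x Ax|cf x Ax].
    apply: (@continuous_comp _ _ _ f (fun N : 'rV_n => N ord0 j)); first exact: cf.
    exact: coord_continuous.
  rewrite (coordf_sum f); elim/big_ind: _ => [|g h cg ch|j _].
  - exact: cst_continuous.
  - exact: continuousD.
  - exact: (@cvgZr_tmp _ _ _ (nbhs x) _ (coordf f j) _ _ (cf j x Ax)).
split=> [[df ck] j|cf]; first split=> [x Ax|v].
- by have [] := coordf_diff j (df _ Ax).
- have /IH/(_ j) := ck v; apply: Ck_eq => // x Ax.
  have [dj e] := coordf_diff j (df _ Ax).
  by rewrite (deriveE _ dj) e /coordf deriveE //; exact: df.
have df x : A x -> differentiable f x.
  move=> Ax; rewrite (coordf_sum f); apply: differentiable_sum => j.
  by apply: differentiableZl; exact: (cf j).1.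
split=> // v; apply/IH => j; apply: Ck_eq ((cf j).2 v) => // x Ax.
have [dj e] := coordf_diff j (df _ Ax).
by rewrite (deriveE _ dj) e /coordf deriveE //; exact: df.
Qed.

Lemma Ck_comp_scalar k m n (A : set 'rV[R]_m) (B : set 'rV[R]_n)
    (f : 'rV[R]_m -> 'rV[R]_n) (g : 'rV[R]_n -> R) :
  open A -> (forall x, A x -> B (f x)) -> Ck k A f -> Ck k B g ->
  Ck k A (g \o f).
Proof.
move=> oA AB; elim: k f g AB => [|k IH] f g AB cf cg.
  by move=> x Ax; apply: continuous_comp; [exact: cf|apply: cg; exact: AB].
have [df ckf] := cf; have [dg ckg] := cg.
split=> [x Ax|v].
  by apply: differentiable_comp; [exact: df|apply: dg; exact: AB].
have : Ck k A (\sum_(j < n) coordf ('D_v f) j * ('D_(delta_mx 0 j) g \o f)).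
  apply: Ck_sum => // j; apply: CkM => //.
    by apply: (iffLR (Ck_coord _ _ oA)); exact: ckf.
  by apply: IH; [exact: AB|exact: CkS cf|exact: ckg].
apply: Ck_eq => // x Ax.
have dfx := df _ Ax; have dgx := dg _ (AB _ Ax).
rewrite deriveE; last exact: differentiable_comp.
rewrite diff_comp //= [in RHS](row_sum_delta ('d f x v)) linear_sum fct_sumE.
apply: eq_bigr => j _; rewrite linearZ !fctE /= /coordf !deriveE //.
Qed.

Lemma Ck_comp k m n p (A : set 'rV[R]_m) (B : set 'rV[R]_n)
    (f : 'rV[R]_m -> 'rV[R]_n) (g : 'rV[R]_n -> 'rV[R]_p) :
  open A -> open B -> (forall x, A x -> B (f x)) -> Ck k A f -> Ck k B g ->
  Ck k A (g \o f).
Proof.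
move=> oA oB AB cf /(Ck_coord _ _ oB) cg; apply/(Ck_coord _ _ oA) => j.
exact: (Ck_comp_scalar oA AB cf (cg j)).
Qed.

Lemma Ck_id k m (A : set 'rV[R]_m) : Ck k A id.
Proof.
case: k => [|k]; first by move=> x _ P; exact: id.
split=> [x _|v]; first exact: ex_diff.
have -> : 'D_v (id : 'rV[R]_m -> _) = cst v by apply/funext => x; rewrite derive_id.
exact: Ck_cst.
Qed.

End Smooth.

Section Topology.

Definition homeomorphism (X Y : topologicalType) (f : X -> Y) : Prop :=
  continuous f /\ exists g : Y -> X, [/\ cancel f g, cancel g f & continuous g].

(* homeomorphism onto the image, the image carrying the subspace topology *)
Definition topological_embedding (X Y : topologicalType) (f : X -> Y) : Prop :=
  exists h : X -> range f, (forall x, \val (h x) = f x) /\ homeomorphism h.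

Definition locally_finite (X : topologicalType) (I : Type) (D : set I)
    (F : I -> set X) : Prop :=
  forall x : X, exists2 W, nbhs x W & finite_set [set i | D i /\ F i `&` W !=set0].

Definition paracompact (X : topologicalType) : Prop :=
  forall C : set (set X), C `<=` open -> cover C id = setT ->
  exists D : set (set X),
    [/\ D `<=` open, cover D id = setT, locally_finite D id &
        forall A, D A -> exists2 B, C B & A `<=` B].

Definition contractible (R : realType) (X : topologicalType) : Prop :=
  exists (p : X) (H : (`[0%R, 1%R]%classic : set R) * X -> X),
    [/\ continuous H,
        forall t x, \val t = 0 -> H (t, x) = x &
        forall t x, \val t = 1 -> H (t, x) = p].

Lemma topological_embeddingP (X Y : topologicalType) (f : X -> Y) :
  topological_embedding f <->
  [/\ injective f, continuous f &
      forall x U, nbhs x U -> exists2 V, nbhs (f x) V & f @^-1` V `<=` U].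
Proof.
split=> [[h [hf [ch [k [hK kK ck]]]]]|[injf cf nf]].
  split=> [x y fxy|x|x U xU].
  - by apply: (can_inj hK); apply: val_inj; rewrite /= !hf.
  - have -> : f = set_val \o h by apply/funext => y; rewrite -hf.
    by apply: continuous_comp; [exact: ch|exact: initial_continuous].
  - have : nbhs (h x) (k @^-1` U) by apply: ck; rewrite hK.
    move=> [_ [[W oW <-] Wx WU]].
    exists W; first by apply: open_nbhs_nbhs; split; rewrite // -hf.
    by move=> y Wy; rewrite -(hK y); apply: WU; rewrite /= set_valE hf.
pose h x : range f := exist _ (f x) (mem_set (imageT f x)).
have surj (y : range f) : exists x, h x = y.
  by have [x _ e] := set_mem (valP y); exists x; apply: val_inj.
pose k y := sval (cid (surj y)).
have kK : cancel k h by move=> y; rewrite /k; case: cid.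
have hK : cancel h k.
  by move=> x; apply: injf; have /(congr1 set_val) := kK (h x).
exists h; split=> //; split; first exact: continuous_comp_initial.
have fk y : f (k y) = set_val y by rewrite -[in RHS](kK y).
exists k; split=> // y U /nf[V yV VU].
have : nbhs y (set_val @^-1` V) by apply: initial_continuous; rewrite -fk.
by apply: filterS => z Vz; apply: VU; rewrite /= fk.
Qed.

Lemma topological_embedding_id (X : topologicalType) :
  topological_embedding (id : X -> X).
Proof.
apply/topological_embeddingP; split=> [x y|x U|x U xU] //; by exists U.
Qed.

Lemma topological_embedding_comp (X Y Z : topologicalType) (f : X -> Y)
    (g : Y -> Z) : topological_embedding f -> topological_embedding g ->
  topological_embedding (g \o f).
Proof.
move=> /topological_embeddingP[fi fc fn] /topological_embeddingP[gi gc gn].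
apply/topological_embeddingP; split=> [x y /gi/fi|x|x U xU] //.
  by apply: continuous_comp; [exact: fc|exact: gc].
have [V fV VU] := fn _ _ xU; have [W gW WV] := gn _ _ fV.
by exists W => // y /WV; exact: VU.
Qed.

End Topology.

(* Maps between subsets of euclidean spaces are functions on the subtypes, so
   that Leibniz equality of such maps is equality on the domain only. *)
Section EuclideanMaps.
Context {R : realType}.

Definition extends m n (A : set 'rV[R]_m) (B : set 'rV[R]_n) (f : A -> B)
  (F : 'rV[R]_m -> 'rV[R]_n) : Prop := forall x : A, F (\val x) = \val (f x).

(* A is open in all uses, hence smoothness of f does not depend on the values
   of the extension outside A. *)
Definition smooth_map m n (A : set 'rV[R]_m) (B : set 'rV[R]_n)
  (f : A -> B) : Prop := exists2 F, extends f F & smooth_on A F.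

Definition diffeomorphism n (A : set 'rV[R]_n) (f : A -> A) : Prop :=
  smooth_map f /\ exists g : A -> A, [/\ cancel f g, cancel g f & smooth_map g].

Definition immersion m n (A : set 'rV[R]_m) (B : set 'rV[R]_n)
  (f : A -> B) : Prop :=
  exists F, [/\ extends f F, smooth_on A F &
                forall x, A x -> injective ('d F x)].

Definition smooth_embedding m n (A : set 'rV[R]_m) (B : set 'rV[R]_n)
  (f : A -> B) : Prop := immersion f /\ topological_embedding f.

Lemma smooth_embedding_id n (A : set 'rV[R]_n) :
  smooth_embedding (id : A -> A).
Proof.
split; last exact: topological_embedding_id.
exists id; split=> [//|k|x Ax]; first exact: Ck_id.
have /= e := @diff_val _ _ _ _ _ _ _ (is_diff_id x).
by move=> u v; rewrite e.
Qed.

Lemma smooth_embedding_comp m n p (A : set 'rV[R]_m) (B : set 'rV[R]_n)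
    (C : set 'rV[R]_p) (f : A -> B) (g : B -> C) : open A -> open B ->
  smooth_embedding f -> smooth_embedding g -> smooth_embedding (g \o f).
Proof.
move=> oA oB [[F [fF sF iF]] tf] [[G [gG sG iG]] tg].
split; last exact: topological_embedding_comp.
have FB x : A x -> B (F x).
  move=> /mem_set Ax; rewrite (fF (exist _ x Ax)).
  exact: set_mem (valP (f _)).
exists (G \o F); split=> [x|k|x Ax].
- by rewrite /= fF gG.
- exact: (Ck_comp oA oB).
- rewrite diff_comp /=; [|exact: (sF 1).1|exact: (sG 1).1 _ (FB _ Ax)].
  by move=> u v /(iG _ (FB _ Ax)) /(iF _ Ax).
Qed.

Record diff_group n (A : set 'rV[R]_n) := DiffGroup {
  dg_set : set (A -> A);
  dg_finite : finite_set dg_set;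
  dg_diff : forall g, dg_set g -> diffeomorphism g;
  dg_one : dg_set id;
  dg_mul : forall g h, dg_set g -> dg_set h -> dg_set (g \o h);
  dg_inv : forall g, dg_set g ->
    exists2 h, dg_set h & cancel g h /\ cancel h g }.

Section OrbitSpace.
Variables (n : nat) (A : set 'rV[R]_n) (G : diff_group A).

Definition same_orbit : rel A := fun x y => `[< exists2 g, dg_set G g & g x = y >].

Lemma same_orbit_refl : reflexive same_orbit.
Proof. by move=> x; apply/asboolP; exists id => //; exact: dg_one. Qed.

Lemma same_orbit_sym : symmetric same_orbit.
Proof.
have H x y : same_orbit x y -> same_orbit y x.
  move=> /asboolP[g Gg <-]; have [h Gh [gK _]] := dg_inv Gg.
  by apply/asboolP; exists h.
by move=> x y; apply/idP/idP; exact: H.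
Qed.

Lemma same_orbit_trans : transitive same_orbit.
Proof.
move=> y x z /asboolP[g Gg <-] /asboolP[h Gh <-].
by apply/asboolP; exists (h \o g) => //; exact: dg_mul.
Qed.

Definition orbit_equiv :=
  EquivRel same_orbit same_orbit_refl same_orbit_sym same_orbit_trans.

Definition orbit_space := quotient_topology {eq_quot orbit_equiv}.

HB.instance Definition _ := Topological.on orbit_space.
HB.instance Definition _ := Quotient.on orbit_space.

Definition to_orbit : A -> orbit_space := \pi_(orbit_space)%qT.

End OrbitSpace.
End EuclideanMaps.

Section Charts.
Context {R : realType} {n : nat} {X : topologicalType}.

(* The range of ch_proj is the uniformized set U.  Effectiveness is automatic
   for a group of functions. *)
Record chart := Chart {
  ch_dom : set 'rV[R]_n;
  ch_group : diff_group ch_dom;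
  ch_proj : ch_dom -> X;
  ch_dom_open : open ch_dom;
  ch_dom_connected : connected ch_dom;
  ch_effective : forall g, dg_set ch_group g -> (forall x, g x = x) -> g = id;
  ch_supp_open : open (range ch_proj);
  ch_supp_connected : connected (range ch_proj);
  ch_continuous : continuous ch_proj;
  ch_invariant : forall g, dg_set ch_group g -> forall x, ch_proj (g x) = ch_proj x;
  ch_quotient : exists phi : orbit_space ch_group -> range ch_proj,
    (forall x, \val (phi (to_orbit ch_group x)) = ch_proj x) /\
    homeomorphism phi }.

Definition ch_supp (c : chart) : set X := range (@ch_proj c).

Definition is_embedding (c d : chart) (l : ch_dom c -> ch_dom d) : Prop :=
  [/\ ch_supp c `<=` ch_supp d, smooth_embedding l &
      forall x, ch_proj (l x) = ch_proj x].

Definition embedding (c d : chart) := {l | @is_embedding c d l}.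

Lemma is_embedding_id c : @is_embedding c c id.
Proof. by split=> //; exact: smooth_embedding_id. Qed.

Lemma is_embedding_comp c d e (l : ch_dom c -> ch_dom d)
    (m : ch_dom d -> ch_dom e) :
  is_embedding l -> is_embedding m -> is_embedding (m \o l).
Proof.
move=> [cd sl pl] [de sm pm]; split=> [x /cd/de//||x]; last by rewrite /= pm pl.
by apply: smooth_embedding_comp => //; exact: ch_dom_open.
Qed.

Definition embedding_id c : embedding c c := exist _ _ (is_embedding_id c).

Definition embedding_comp c d e (l : embedding c d) (m : embedding d e) :
  embedding c e := exist _ _ (is_embedding_comp (svalP l) (svalP m)).

Lemma embedding_eq c d (l m : embedding c d) : sval l = sval m -> l = m.
Proof. by move: l m => [l pl] [m pm] /= lm; exact: eq_exist. Qed.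

Definition is_atlas (I : Type) (c : I -> chart) : Prop :=
  cover setT (fun i => ch_supp (c i)) = setT /\
  forall i j x, ch_supp (c i) x -> ch_supp (c j) x ->
    exists k, [/\ ch_supp (c k) x,
      ch_supp (c k) `<=` ch_supp (c i) `&` ch_supp (c j),
      inhabited (embedding (c k) (c i)) &
      inhabited (embedding (c k) (c j))].

End Charts.
Arguments chart R n X : clear implicits.

(* Composition is written in diagrammatic order: cmp f g is "f, then g". *)
Record category := Category {
  obj :> Type;
  hom : obj -> obj -> Type;
  idn : forall a, hom a a;
  cmp : forall a b c, hom a b -> hom b c -> hom a c;
  cmp_idl : forall a b (f : hom a b), cmp (idn a) f = f;
  cmp_idr : forall a b (f : hom a b), cmp f (idn b) = f;
  cmp_assoc : forall a b c d (f : hom a b) (g : hom b c) (h : hom c d),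
    cmp (cmp f g) h = cmp f (cmp g h) }.
Arguments hom {C} a b : rename.
Arguments idn {C} a : rename.
Arguments cmp {C a b c} f g : rename.

Record functor (C D : category) := Functor {
  fob :> C -> D;
  fhom : forall a b, hom a b -> hom (fob a) (fob b);
  fhom_id : forall a, fhom (idn a) = idn (fob a);
  fhom_cmp : forall a b c (f : hom a b) (g : hom b c),
    fhom (cmp f g) = cmp (fhom f) (fhom g) }.
Arguments fhom {C D} F {a b} f : rename.

Record nat_trans (C D : category) (F G : functor C D) := NatTrans {
  component :> forall a, hom (F a) (G a);
  naturality : forall a b (f : hom a b),
    cmp (component a) (fhom G f) = cmp (fhom F f) (component b) }.

Section Cat.

Definition functor_id (C : category) : functor C C :=
  @Functor C C id (fun _ _ f => f) (fun _ => erefl) (fun _ _ _ _ _ => erefl).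

Program Definition functor_comp (C D E : category) (F : functor C D)
    (G : functor D E) : functor C E :=
  @Functor C E (G \o F) (fun _ _ f => fhom G (fhom F f)) _ _.
Next Obligation. by move=> * /=; rewrite !fhom_id. Qed.
Next Obligation. by move=> * /=; rewrite !fhom_cmp. Qed.

Program Definition nt_id (C D : category) (F : functor C D) : nat_trans F F :=
  @NatTrans C D F F (fun a => idn (F a)) _.
Next Obligation. by move=> *; rewrite cmp_idl cmp_idr. Qed.

Program Definition nt_vcomp (C D : category) (F G H : functor C D)
    (s : nat_trans F G) (t : nat_trans G H) : nat_trans F H :=
  @NatTrans C D F H (fun a => cmp (s a) (t a)) _.
Next Obligation.
by move=> *; rewrite cmp_assoc naturality -!cmp_assoc naturality.
Qed.

Program Definition nt_hcomp (C D E : category) (F F' : functor C D)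
    (G G' : functor D E) (s : nat_trans F F') (t : nat_trans G G') :
    nat_trans (functor_comp F G) (functor_comp F' G') :=
  @NatTrans C E _ _ (fun a => cmp (fhom G (s a)) (t (F' a))) _.
Next Obligation.
by move=> * /=; rewrite cmp_assoc naturality -!cmp_assoc -!fhom_cmp naturality.
Qed.

End Cat.

(* Strict 2-categories; 1-cells and 2-cells are composed in diagrammatic
   order. *)
Record two_cat_data := TwoCatData {
  cell0 : Type;
  cell1 : cell0 -> cell0 -> Type;
  cell2 : forall A B, cell1 A B -> cell1 A B -> Type;
  id1 : forall A, cell1 A A;
  comp1 : forall A B C, cell1 A B -> cell1 B C -> cell1 A C;
  id2 : forall A B (f : cell1 A B), cell2 f f;
  vcomp : forall A B (f g h : cell1 A B), cell2 f g -> cell2 g h -> cell2 f h;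
  hcomp : forall A B C (f f' : cell1 A B) (g g' : cell1 B C),
    cell2 f f' -> cell2 g g' -> cell2 (comp1 f g) (comp1 f' g') }.
Arguments cell1 {T} A B : rename.
Arguments cell2 {T A B} f g : rename.
Arguments id1 {T} A : rename.
Arguments comp1 {T A B C} f g : rename.
Arguments id2 {T A B} f : rename.
Arguments vcomp {T A B f g h} a b : rename.
Arguments hcomp {T A B C f f' g g'} a b : rename.

(* Transport of 2-cells along equalities of 1-cells, needed to state the unit
   and associativity laws of hcomp. *)
Definition cast2 (T : two_cat_data) (A B : cell0 T) (f f' g g' : cell1 A B)
    (ef : f = f') (eg : g = g') (a : cell2 f g) : cell2 f' g' :=
  ecast z (cell2 f' z) eg (ecast z (cell2 z g) ef a).

Record is_two_category (T : two_cat_data) : Prop := IsTwoCategory {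
  vcomp_idl : forall (A B : cell0 T) (f g : cell1 A B) (a : cell2 f g),
    vcomp (id2 f) a = a;
  vcomp_idr : forall (A B : cell0 T) (f g : cell1 A B) (a : cell2 f g),
    vcomp a (id2 g) = a;
  vcomp_assoc : forall (A B : cell0 T) (f g h k : cell1 A B)
    (a : cell2 f g) (b : cell2 g h) (c : cell2 h k),
    vcomp (vcomp a b) c = vcomp a (vcomp b c);
  comp1_idl : forall (A B : cell0 T) (f : cell1 A B), comp1 (id1 A) f = f;
  comp1_idr : forall (A B : cell0 T) (f : cell1 A B), comp1 f (id1 B) = f;
  comp1_assoc : forall (A B C D : cell0 T)
    (f : cell1 A B) (g : cell1 B C) (h : cell1 C D),
    comp1 (comp1 f g) h = comp1 f (comp1 g h);
  hcomp_id2 : forall (A B C : cell0 T) (f : cell1 A B) (g : cell1 B C),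
    hcomp (id2 f) (id2 g) = id2 (comp1 f g);
  interchange : forall (A B C : cell0 T)
    (f f' f'' : cell1 A B) (g g' g'' : cell1 B C)
    (a : cell2 f f') (a' : cell2 f' f'') (b : cell2 g g') (b' : cell2 g' g''),
    hcomp (vcomp a a') (vcomp b b') = vcomp (hcomp a b) (hcomp a' b');
  hcomp_idl : forall (A B : cell0 T) (f g : cell1 A B) (a : cell2 f g),
    cast2 (comp1_idl f) (comp1_idl g) (hcomp (id2 (id1 A)) a) = a;
  hcomp_idr : forall (A B : cell0 T) (f g : cell1 A B) (a : cell2 f g),
    cast2 (comp1_idr f) (comp1_idr g) (hcomp a (id2 (id1 B))) = a;
  hcomp_assoc : forall (A B C D : cell0 T) (f f' : cell1 A B)
    (g g' : cell1 B C) (h h' : cell1 C D)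
    (a : cell2 f f') (b : cell2 g g') (c : cell2 h h'),
    cast2 (comp1_assoc f g h) (comp1_assoc f' g' h') (hcomp (hcomp a b) c) =
    hcomp a (hcomp b c) }.

Section GoodAtlases.
Context {R : realType} {n : nat}.

Program Definition atlas_category (X : topologicalType) (I : Type)
    (c : I -> chart R n X) : category :=
  @Category I (fun i j => embedding (c i) (c j))
    (fun i => embedding_id (c i))
    (fun _ _ _ l m => embedding_comp l m) _ _ _.
Next Obligation. by move=> *; exact: embedding_eq. Qed.
Next Obligation. by move=> *; exact: embedding_eq. Qed.
Next Obligation. by move=> *; exact: embedding_eq. Qed.

Definition Fin (V : choiceType) := {I : {fset V} | I != fset0}.

Definition is_union (V : choiceType) (p : nat) (J : 'I_p.+1 -> Fin V)
  (I : Fin V) : Prop := \val I = (\big[fsetU/fset0]_(k < p.+1) \val (J k))%fset.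

Lemma fset1_neq0 (V : choiceType) (i : V) : [fset i]%fset != fset0.
Proof. by apply/fset0Pn; exists i; rewrite fset11. Qed.

Definition Fin1 (V : choiceType) (i : V) : Fin V :=
  exist _ [fset i]%fset (fset1_neq0 i).

Record good_atlas_on (X : topologicalType) (V : choiceType)
    (c : Fin V -> chart R n X) : Prop := GoodAtlasOn {
  ga_is_atlas : is_atlas c;
  ga_countable : countable [set: V];
  ga_cover : cover setT (fun i => ch_supp (c (Fin1 i))) = setT;
  ga_locally_finite : locally_finite setT (fun i => ch_supp (c (Fin1 i)));
  ga_contractible_dom : forall I, ch_dom (c I) !=set0 ->
    contractible R (ch_dom (c I));
  ga_contractible_supp : forall I, ch_supp (c I) !=set0 ->
    contractible R (ch_supp (c I));
  ga_inter : forall p (J : 'I_p.+1 -> Fin V) (I : Fin V), is_union J I ->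
    ch_supp (c I) = \bigcap_k ch_supp (c (J k));
  ga_embedding : forall I J, ch_supp (c I) `<=` ch_supp (c J) ->
    inhabited (embedding (c I) (c J)) }.

Record good_atlas := GoodAtlas {
  ga_space : topologicalType;
  ga_paracompact : paracompact ga_space;
  ga_second_countable : second_countable (T := ga_space);
  ga_hausdorff : hausdorff_space ga_space;
  ga_index : choiceType;
  ga_chart :> Fin ga_index -> chart R n ga_space;
  ga_good : good_atlas_on ga_chart }.

Definition ga_category (U : good_atlas) : category := atlas_category U.

Record system_data (U V : good_atlas) := SystemData {
  sys_map : ga_space U -> ga_space V;
  sys_functor : functor (ga_category U) (ga_category V);
  sys_lift : forall I : Fin (ga_index U),
    ch_dom (U I) -> ch_dom (V (sys_functor I)) }.

Record is_compatible (U V : good_atlas) (f : system_data U V) : Prop :=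
    IsCompatible {
  compat_continuous : continuous (sys_map f);
  compat_image : forall I,
    sys_map f @` ch_supp (U I) `<=` ch_supp (V (sys_functor f I));
  compat_union : forall p (J : 'I_p.+1 -> Fin (ga_index U)) I,
    is_union J I -> is_union (fun k => sys_functor f (J k)) (sys_functor f I);
  compat_smooth : forall I, smooth_map (sys_lift f (I := I));
  compat_lift : forall I (x : ch_dom (U I)),
    ch_proj (sys_lift f x) = sys_map f (ch_proj x);
  compat_embedding : forall I J (l : embedding (U I) (U J)) (x : ch_dom (U I)),
    sys_lift f (sval l x) =
    sval (fhom (sys_functor f) (l : @hom (ga_category U) I J)) (sys_lift f x) }.

Definition sys_id (U : good_atlas) : system_data U U :=
  @SystemData U U id (functor_id _) (fun _ => id).

Definition sys_comp (U V W : good_atlas) (f : system_data U V)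
    (g : system_data V W) : system_data U W :=
  @SystemData U W (sys_map g \o sys_map f)
    (functor_comp (sys_functor f) (sys_functor g))
    (fun I x => sys_lift g (sys_lift f x)).

Definition compatible_system (U V : good_atlas) :=
  {f : system_data U V | is_compatible f}.

Definition is_compatible_nt (U V : good_atlas) (f g : system_data U V)
    (a : nat_trans (sys_functor f) (sys_functor g)) : Prop :=
  sys_map f = sys_map g /\
  forall I (x : ch_dom (U I)), sys_lift g x = sval (a I) (sys_lift f x).

Definition compatible_nt (U V : good_atlas) (f g : compatible_system U V) :=
  {a : nat_trans (sys_functor (sval f)) (sys_functor (sval g)) |
    is_compatible_nt a}.

End GoodAtlases.
Arguments good_atlas R n : clear implicits.

Section Closure.
Variables (R : realType) (n : nat).

Definition sys_id_closed : Prop :=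
  forall U : good_atlas R n, is_compatible (sys_id U).

Definition sys_comp_closed : Prop :=
  forall (U V W : good_atlas R n) (f : system_data U V) (g : system_data V W),
  is_compatible f -> is_compatible g -> is_compatible (sys_comp f g).

Definition nt_id_closed : Prop :=
  forall (U V : good_atlas R n) (f : system_data U V), is_compatible f ->
  is_compatible_nt (nt_id (sys_functor f)).

Definition nt_vcomp_closed : Prop :=
  forall (U V : good_atlas R n) (f g h : system_data U V)
    (a : nat_trans (sys_functor f) (sys_functor g))
    (b : nat_trans (sys_functor g) (sys_functor h)),
  is_compatible f -> is_compatible g -> is_compatible h ->
  is_compatible_nt a -> is_compatible_nt b -> is_compatible_nt (nt_vcomp a b).

Definition nt_hcomp_closed : Prop :=
  forall (U V W : good_atlas R n) (f f' : system_data U V)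
    (g g' : system_data V W)
    (a : nat_trans (sys_functor f) (sys_functor f'))
    (b : nat_trans (sys_functor g) (sys_functor g')),
  is_compatible f -> is_compatible f' -> is_compatible g -> is_compatible g' ->
  is_compatible_nt a -> is_compatible_nt b ->
  @is_compatible_nt _ _ _ _ (sys_comp f g) (sys_comp f' g') (nt_hcomp a b).

End Closure.

Section GOrbAtl.
Variables (R : realType) (n : nat).
Hypotheses (id1P : sys_id_closed R n) (comp1P : sys_comp_closed R n).
Hypotheses (id2P : nt_id_closed R n) (vcompP : nt_vcomp_closed R n).
Hypothesis (hcompP : nt_hcomp_closed R n).
Local Notation atl := (good_atlas R n).

Definition gorb_id1 (U : atl) : compatible_system U U :=
  exist _ (sys_id U) (id1P U).

Definition gorb_comp1 (U V W : atl) (f : compatible_system U V)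
    (g : compatible_system V W) : compatible_system U W :=
  exist _ (sys_comp (sval f) (sval g)) (comp1P (svalP f) (svalP g)).

Definition gorb_id2 (U V : atl) (f : compatible_system U V) :
    compatible_nt f f :=
  exist _ (nt_id _) (id2P (svalP f)).

Definition gorb_vcomp (U V : atl) (f g h : compatible_system U V)
    (a : compatible_nt f g) (b : compatible_nt g h) : compatible_nt f h :=
  exist _ (nt_vcomp (sval a) (sval b))
    (vcompP (svalP f) (svalP g) (svalP h) (svalP a) (svalP b)).

Definition gorb_hcomp (U V W : atl) (f f' : compatible_system U V)
    (g g' : compatible_system V W)
    (a : compatible_nt f f') (b : compatible_nt g g') :
    compatible_nt (gorb_comp1 f g) (gorb_comp1 f' g') :=
  exist _ (nt_hcomp (sval a) (sval b))
    (hcompP (svalP f) (svalP f') (svalP g) (svalP g') (svalP a) (svalP b)).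

Definition GOrbAtl : two_cat_data :=
  @TwoCatData atl (@compatible_system R n) (@compatible_nt R n)
    gorb_id1 gorb_comp1 gorb_id2 gorb_vcomp gorb_hcomp.

End GOrbAtl.

(* Main.v *)
Require Import Defs.
From mathcomp Require Import all_boot all_order all_algebra.
From mathcomp Require Import all_classical all_reals all_analysis.

(** The 2-category of good atlases lives over [Cat]: a compatible system is a
    functor decorated with a continuous map and with smooth liftings, and a
    2-cell is a natural transformation subject to an equation on the liftings.
    There are therefore two things to see.

    - The compositions and identities of [Cat] respect the decorations.  For
      1-cells this is the chain rule ([smooth_map_comp]) and pasting of
      squares.  For horizontal composition ([nt_hcomp_compatible]) the
      equation is
      [g'_{f'I} f'_I = b_{f'I} g_{f'I} a_I f_I
                     = b_{f'I} (g a_I) g_{fI} f_I],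
      where the last step is the compatibility of [g] with the embedding
      [a_I].

    - The laws of a strict 2-category are inherited from [Cat].  All the
      conditions imposed on 1-cells and 2-cells are propositions, so 1-cells
      agree as soon as their maps, functors and liftings do, and 2-cells agree
      as soon as their components do ([compatible_nt_eq]).

    The one delicate point is that the unit and associativity laws for
    horizontal composition compare 2-cells whose boundaries are equal but not
    convertible: composite functors carry different proofs of functoriality.
    On objects, however, the two functors are convertible, so a transport
    along such an equality acts trivially on components ([component_cast2]
    and [ecast_id]), and the laws become identities between embeddings in a
    single hom-set. *)

Set Implicit Arguments.
Unset Strict Implicit.
Unset Printing Implicit Defensive.

Import numFieldNormedType.Exports.
Local Open Scope classical_set_scope.

(** * Closure under compositions and identities *)

Section Closure.
Context {R : realType}.

Lemma smooth_map_id m (A : set 'rV[R]_m) : smooth_map (id : A -> A).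
Proof. by exists id => // k; exact: Ck_id. Qed.

Lemma smooth_map_comp m n p (A : set 'rV[R]_m) (B : set 'rV[R]_n)
    (C : set 'rV[R]_p) (f : A -> B) (g : B -> C) :
  open A -> open B -> smooth_map f -> smooth_map g -> smooth_map (g \o f).
Proof.
move=> oA oB [F fF sF] [G gG sG]; exists (G \o F) => [x|k].
  by rewrite /= fF gG.
apply: (Ck_comp oA oB) => // x /mem_set Ax.
rewrite (fF (exist _ x Ax)); exact: set_mem (valP (f _)).
Qed.

Context {n : nat}.
Implicit Types U V W : good_atlas R n.

Lemma sys_id_compatible U : is_compatible (sys_id U).
Proof.
split=> //=.
- by move=> x; exact: cvg_id.
- by move=> I _ [x Ux <-].
- by move=> I; exact: smooth_map_id.
Qed.

Lemma sys_comp_compatible U V W (f : system_data U V) (g : system_data V W) :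
  is_compatible f -> is_compatible g -> is_compatible (sys_comp f g).
Proof.
move=> fP gP; split=> /=.
- by move=> x; apply: continuous_comp;
    [exact: compat_continuous fP _|exact: compat_continuous gP _].
- move=> I _ [x Ux <-]; apply: (compat_image gP).
  by exists (sys_map f x) => //; apply: (compat_image fP); exists x.
- by move=> p J I /(compat_union fP)/(compat_union gP).
- by move=> I; apply: smooth_map_comp; try exact: ch_dom_open;
    [exact: (compat_smooth fP)|exact: (compat_smooth gP)].
- by move=> I x; rewrite (compat_lift gP) (compat_lift fP).
- by move=> I J l x; rewrite (compat_embedding fP) (compat_embedding gP).
Qed.

Lemma nt_id_compatible U V (f : system_data U V) :
  is_compatible_nt (nt_id (sys_functor f)).
Proof. by []. Qed.

Lemma nt_vcomp_compatible U V (f g h : system_data U V)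
    (a : nat_trans (sys_functor f) (sys_functor g))
    (b : nat_trans (sys_functor g) (sys_functor h)) :
  is_compatible_nt a -> is_compatible_nt b -> is_compatible_nt (nt_vcomp a b).
Proof.
by move=> [fg ag] [gh bh]; split=> [|I x]; [rewrite fg|rewrite bh ag].
Qed.

(** The component of the horizontal composite at [I] first applies [g] to the
    embedding [a_I], and the compatibility of [g] with embeddings is what lets
    [g a_I] slide past the lifting of [g]. *)
Lemma nt_hcomp_compatible U V W (f f' : system_data U V)
    (g g' : system_data V W)
    (a : nat_trans (sys_functor f) (sys_functor f'))
    (b : nat_trans (sys_functor g) (sys_functor g')) :
  is_compatible g -> is_compatible_nt a -> is_compatible_nt b ->
  @is_compatible_nt _ _ _ _ (sys_comp f g) (sys_comp f' g') (nt_hcomp a b).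
Proof.
move=> gP [ff' af'] [gg' bg']; split=> [|I x] /=; first by rewrite ff' gg'.
by rewrite bg' af' (compat_embedding gP).
Qed.

End Closure.

(** * Equality of 1-cells and of 2-cells *)

Section Extensionality.

Lemma nat_trans_eq (C D : category) (F G : functor C D) (a b : nat_trans F G) :
  (forall x, a x = b x) -> a = b.
Proof.
case: a b => [a pa] [b pb] /= ab.
have e : a = b by exact: functional_extensionality_dep.
by rewrite -{}e in pb *; congr NatTrans; exact: Prop_irrelevance.
Qed.

Context {R : realType} {n : nat}.
Implicit Types U V : good_atlas R n.

(** The type of the liftings depends on the functor only through its object
    part, so replacing the proofs of functoriality requires no transport.  This
    covers the unit and associativity laws for 1-cells, where all the data are
    convertible. *)
Lemma system_data_functoriality_irrelevance U V
    (m : ga_space U -> ga_space V) (ob : ga_category U -> ga_category V)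
    (hm : forall I J, Defs.hom I J -> Defs.hom (ob I) (ob J)) p p' q q'
    (l : forall I : Fin (ga_index U), ch_dom (U I) -> ch_dom (V (ob I))) :
  @SystemData R n U V m (@Functor _ _ ob hm p q) l =
  @SystemData R n U V m (@Functor _ _ ob hm p' q') l.
Proof. by rewrite (Prop_irrelevance p p') (Prop_irrelevance q q'). Qed.

Lemma compatible_nt_eq U V (f g : compatible_system U V)
    (a b : compatible_nt f g) : (forall I, sval a I = sval b I) -> a = b.
Proof.
case: a b => [a pa] [b pb] /= ab.
by apply: eq_exist; exact: nat_trans_eq.
Qed.

End Extensionality.

Lemma ecast_id (T : Type) (P : T -> Type) x (e : x = x) (p : P x) :
  ecast z (P z) e p = p.
Proof. by rewrite (Prop_irrelevance e erefl). Qed.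

(** * Horizontal composition in Cat, on components *)

(** Stated on components, the laws need no transport and hold for arbitrary
    functors between categories. *)
Section CatLaws.
Variables (C D E E' : category).

Lemma nt_hcomp_id (F : functor C D) (G : functor D E) x :
  nt_hcomp (nt_id F) (nt_id G) x = nt_id (functor_comp F G) x.
Proof. by rewrite /= fhom_id cmp_idl. Qed.

Lemma nt_interchange (F F' F'' : functor C D) (G G' G'' : functor D E)
    (a : nat_trans F F') (a' : nat_trans F' F'')
    (b : nat_trans G G') (b' : nat_trans G' G'') x :
  nt_hcomp (nt_vcomp a a') (nt_vcomp b b') x =
  nt_vcomp (nt_hcomp a b) (nt_hcomp a' b') x.
Proof.
(* Only the two inner factors have to be exchanged, by naturality of [b]. *)
rewrite /= fhom_cmp !cmp_assoc; congr cmp.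
by rewrite -!cmp_assoc naturality.
Qed.

Lemma nt_hcomp_idl (F G : functor C D) (a : nat_trans F G) x :
  nt_hcomp (nt_id (functor_id C)) a x = a x.
Proof. by rewrite /= fhom_id cmp_idl. Qed.

Lemma nt_hcomp_idr (F G : functor C D) (a : nat_trans F G) x :
  nt_hcomp a (nt_id (functor_id D)) x = a x.
Proof. exact: cmp_idr. Qed.

Lemma nt_hcomp_assoc (F F' : functor C D) (G G' : functor D E)
    (H H' : functor E E') (a : nat_trans F F') (b : nat_trans G G')
    (c : nat_trans H H') x :
  nt_hcomp (nt_hcomp a b) c x = nt_hcomp a (nt_hcomp b c) x.
Proof. by rewrite /= fhom_cmp cmp_assoc. Qed.

End CatLaws.

(** * The laws of a 2-category *)

Section TwoCategoryLaws.
Variables (R : realType) (n : nat).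

Let id1P : sys_id_closed R n := @sys_id_compatible R n.
Let comp1P : sys_comp_closed R n := @sys_comp_compatible R n.
Let id2P : nt_id_closed R n := fun U V f _ => nt_id_compatible f.
Let vcompP : nt_vcomp_closed R n :=
  fun U V f g h a b _ _ _ => @nt_vcomp_compatible R n U V f g h a b.
Let hcompP : nt_hcomp_closed R n :=
  fun U V W f f' g g' a b _ _ gP _ =>
    @nt_hcomp_compatible R n U V W f f' g g' a b gP.

Local Notation T := (GOrbAtl id1P comp1P id2P vcompP hcompP).

(** Moving the transport inside to the endpoints of each component is what
    makes it removable: there both endpoints are indices of charts, and those
    of the two functors in question are convertible. *)
Lemma component_cast2 (U V : cell0 T) (f f' g g' : cell1 U V)
    (ef : f = f') (eg : g = g') (a : cell2 f g) (I : Fin (ga_index U)) :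
  sval (cast2 ef eg a) I =
  ecast z (@Defs.hom (ga_category V) (sys_functor (sval f') I) z)
    (congr1 (fun h : cell1 U V => sys_functor (sval h) I) eg)
    (ecast z (@Defs.hom (ga_category V) z (sys_functor (sval g) I))
      (congr1 (fun h : cell1 U V => sys_functor (sval h) I) ef) (sval a I)).
Proof. by case: _ / ef; case: _ / eg. Qed.

Lemma gorb_comp1_idl (U V : cell0 T) (f : cell1 U V) : comp1 (id1 U) f = f.
Proof.
case: f => [[m [ob hm p q] l] fP]; apply: eq_exist.
exact: system_data_functoriality_irrelevance.
Qed.

Lemma gorb_comp1_idr (U V : cell0 T) (f : cell1 U V) : comp1 f (id1 V) = f.
Proof.
case: f => [[m [ob hm p q] l] fP]; apply: eq_exist.
exact: system_data_functoriality_irrelevance.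
Qed.

Lemma gorb_comp1_assoc (U V W Z : cell0 T)
    (f : cell1 U V) (g : cell1 V W) (h : cell1 W Z) :
  comp1 (comp1 f g) h = comp1 f (comp1 g h).
Proof.
by apply: eq_exist; exact: system_data_functoriality_irrelevance.
Qed.

Lemma GOrbAtl_is_two_category : is_two_category T.
Proof.
have idl := gorb_comp1_idl; have idr := gorb_comp1_idr.
have assoc := gorb_comp1_assoc.
refine (@IsTwoCategory T _ _ _ idl idr assoc _ _ _ _ _).
- by move=> U V f g a; apply: compatible_nt_eq => I; exact: cmp_idl.
- by move=> U V f g a; apply: compatible_nt_eq => I; exact: cmp_idr.
- by move=> U V f g h k a b c; apply: compatible_nt_eq => I; exact: cmp_assoc.
- by move=> U V W f g; apply: compatible_nt_eq => I; exact: nt_hcomp_id.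
- move=> U V W f f' f'' g g' g'' a a' b b'; apply: compatible_nt_eq => I.
  exact: nt_interchange.
- move=> U V f g a; apply: compatible_nt_eq => I.
  by rewrite component_cast2 !ecast_id; exact: nt_hcomp_idl.
- move=> U V f g a; apply: compatible_nt_eq => I.
  by rewrite component_cast2 !ecast_id; exact: nt_hcomp_idr.
- move=> U V W Z f f' g g' h h' a b c; apply: compatible_nt_eq => I.
  by rewrite component_cast2 !ecast_id; exact: nt_hcomp_assoc.
Qed.

End TwoCategoryLaws.

Theorem proposition2p10 (R : realType) (n : nat) :
  exists (id1P : sys_id_closed R n) (comp1P : sys_comp_closed R n)
         (id2P : nt_id_closed R n) (vcompP : nt_vcomp_closed R n)
         (hcompP : nt_hcomp_closed R n),
    is_two_category (GOrbAtl id1P comp1P id2P vcompP hcompP).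
Proof. by do 5!eexists; exact: GOrbAtl_is_two_category. Qed.
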